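(* Let $k$ be a field of characteristic $0$ and let $G$ be an infinite discrete group. The functor $$\Gamma(G,-):\mathrm{Vec}'_{G/G}\to saYD\text{-ctrmd}$$ from stable $G$-graded $G$-equivariant vector spaces to stable anti-Yetter-Drinfeld contramodules over the Hopf algebra $kG$ is an equivalence.
   Context: $\mathrm{Vec}_{G/G}$ is the category of $G$-equivariant $G$-graded $k$-vector spaces: families $\mathcal{M}=(M_g)_{g\in G}$ with a $G$-action $x:M_g\to M_{xgx^{-1}}$, $x\in G$; morphisms preserve grading and action. $\mathrm{Vec}'_{G/G}$ is the full subcategory of those with $x\cdot m=m$ for all $x\in G$, $m\in M_x$. $kG$ is the group Hopf algebra: $\Delta(g)=g\otimes g$, $\epsilon(g)=1$, $S(g)=g^{-1}$. For a Hopf algebra $H$ (with $\Delta(h)=h^1\otimes h^2$), a right $H$-contramodule is a vector space $N$ with linear $\alpha:\mathrm{Hom}(H,N)\to N$ such that $\alpha(x\mapsto\alpha(h\mapsto f(x\otimes h)))=\alpha(h\mapsto f(h^1\otimes h^2))$ for $f\in\mathrm{Hom}(H\otimes H,N)$ and $\alpha(h\mapsto\epsilon(h)n)=n$. An anti-Yetter-Drinfeld contramodule is a left $H$-module and right $H$-contramodule $N$ with $h\alpha(f)=\alpha(x\mapsto h^2f(S(h^3)xh^1))$ for all $h\in H$, $f\in\mathrm{Hom}(H,N)$; it is stable if $\alpha(r_n)=n$ for all $n\in N$, where $r_n(h)=hn$. Morphisms preserve both structures. $saYD\text{-ctrmd}$ is the category of stable ones for $H=kG$. $\Gamma(G,\mathcal{M})=\prod_{g\in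 G}M_g$ (global sections), with contraaction $\alpha(f)=(f(g)_g)_{g\in G}$ for $f\in\mathrm{Hom}(kG,\prod_gM_g)$ and $G$-action induced from that of $\mathcal{M}$, i.e. $(x\cdot m)_{xgx^{-1}}=x\cdot m_g$. *)

(* Defs.v *)
From HB Require Import structures.
From mathcomp Require Import all_boot all_order all_algebra.
From mathcomp Require Import finmap monalg.
From mathcomp Require Import boolp classical_sets cardinality.

Set Implicit Arguments.
Unset Strict Implicit.
Unset Printing Implicit Defensive.

Import GRing.Theory.
Local Open Scope ring_scope.

Record category := Category {
  cat_obj :> Type;
  cat_hom : cat_obj -> cat_obj -> Type;
  cat_id : forall x, cat_hom x x;
  cat_comp : forall x y z, cat_hom y z -> cat_hom x y -> cat_hom x z;
  cat_idl : forall x y (f : cat_hom x y), cat_comp (cat_id y) f = f;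
  cat_idr : forall x y (f : cat_hom x y), cat_comp f (cat_id x) = f;
  cat_compA : forall x y z t
    (h : cat_hom z t) (g : cat_hom y z) (f : cat_hom x y),
    cat_comp h (cat_comp g f) = cat_comp (cat_comp h g) f }.

Record functor (C D : category) := Functor {
  fun_obj :> C -> D;
  fun_hom : forall x y, cat_hom x y -> cat_hom (fun_obj x) (fun_obj y);
  fun_id : forall x, fun_hom (cat_id x) = cat_id (fun_obj x);
  fun_comp : forall x y z (g : cat_hom y z) (f : cat_hom x y),
    fun_hom (cat_comp g f) = cat_comp (fun_hom g) (fun_hom f) }.

Definition functor_id (C : category) : functor C C :=
  @Functor C C id (fun _ _ f => f) (fun _ => erefl) (fun _ _ _ _ _ => erefl).

Program Definition functor_comp (C D E : category)
    (K : functor D E) (F : functor C D) : functor C E :=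
  @Functor C E (fun x => K (F x)) (fun _ _ f => fun_hom K (fun_hom F f)) _ _.
Next Obligation. by rewrite !fun_id. Qed.
Next Obligation. by rewrite !fun_comp. Qed.

Record nat_iso (C D : category) (F K : functor C D) := NatIso {
  iso_fwd : forall x, cat_hom (F x) (K x);
  iso_bwd : forall x, cat_hom (K x) (F x);
  iso_natural : forall x y (f : cat_hom x y),
    cat_comp (iso_fwd y) (fun_hom F f) = cat_comp (fun_hom K f) (iso_fwd x);
  iso_fwdK : forall x, cat_comp (iso_bwd x) (iso_fwd x) = cat_id (F x);
  iso_bwdK : forall x, cat_comp (iso_fwd x) (iso_bwd x) = cat_id (K x) }.

Definition is_equivalence (C D : category) (F : functor C D) : Prop :=
  exists K : functor D C,
    inhabited (nat_iso (functor_comp K F) (functor_id C)) /\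
    inhabited (nat_iso (functor_comp F K) (functor_id D)).

Definition full_subcat (C : category) (P : C -> Prop) : category :=
  @Category {x : C | P x}
    (fun x y => cat_hom (sval x) (sval y))
    (fun x => cat_id (sval x))
    (fun _ _ _ g f => cat_comp g f)
    (fun _ _ f => cat_idl f) (fun _ _ f => cat_idr f)
    (fun _ _ _ _ h g f => cat_compA h g f).

Definition full_restr (C D : category) (F : functor C D)
    (P : C -> Prop) (Q : D -> Prop) (PQ : forall x, P x -> Q (F x)) :
    functor (full_subcat P) (full_subcat Q) :=
  @Functor (full_subcat P) (full_subcat Q)
    (fun x => exist Q (F (sval x)) (PQ _ (svalP x)))
    (fun _ _ f => fun_hom F f)
    (fun x => fun_id F (sval x))
    (fun _ _ _ g f => fun_comp F g f).

Section LinearHom.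
Variables (k : fieldType) (U V : lmodType k).
Implicit Types f g h : {linear U -> V}.

Lemma linear_ext f g : f =1 g -> f = g.
Proof.
case: f g => [f cf] [g cg] /= /funext e; case: _ / e in cg *.
congr GRing.Linear.Pack.
case: cf => -[?] [?]; case: cg => -[?] [?].
by congr GRing.Linear.Class; [congr GRing.isNmodMorphism.Axioms_
  | congr GRing.isScalable.Axioms_].
Qed.

HB.instance Definition _ := gen_eqMixin {linear U -> V}.
HB.instance Definition _ := gen_choiceMixin {linear U -> V}.

Definition lhom0 : {linear U -> V} := \0.
Definition lhomN f : {linear U -> V} := \- f.
Definition lhomD f g : {linear U -> V} := f \+ g.
Definition lhomZ (a : k) f : {linear U -> V} := a \*: f.

Fact lhomDA : associative lhomD.
Proof. by move=> f g h; apply: linear_ext => x /=; rewrite addrA. Qed.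
Fact lhomDC : commutative lhomD.
Proof. by move=> f g; apply: linear_ext => x /=; rewrite addrC. Qed.
Fact lhom0D : left_id lhom0 lhomD.
Proof. by move=> f; apply: linear_ext => x /=; rewrite add0r. Qed.
Fact lhomND : left_inverse lhom0 lhomN lhomD.
Proof. by move=> f; apply: linear_ext => x /=; rewrite addNr. Qed.

HB.instance Definition _ :=
  GRing.isZmodule.Build {linear U -> V} lhomDA lhomDC lhom0D lhomND.

Fact lhomZA a b f : lhomZ a (lhomZ b f) = lhomZ (a * b) f.
Proof. by apply: linear_ext => x /=; rewrite scalerA. Qed.
Fact lhom1Z : left_id 1 lhomZ.
Proof. by move=> f; apply: linear_ext => x /=; rewrite scale1r. Qed.
Fact lhomZDr : right_distributive lhomZ +%R.
Proof. by move=> a f g; apply: linear_ext => x /=; rewrite scalerDr. Qed.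
Fact lhomZDl f : {morph lhomZ^~ f : a b / a + b}.
Proof. by move=> a b; apply: linear_ext => x /=; rewrite scalerDl. Qed.

HB.instance Definition _ :=
  GRing.Zmodule_isLmodule.Build k {linear U -> V} lhomZA lhom1Z lhomZDr lhomZDl.

Lemma lhomDE f g x : (f + g) x = f x + g x. Proof. by []. Qed.
Lemma lhomZE a f x : (a *: f) x = a *: f x. Proof. by []. Qed.

End LinearHom.

(* An element of U (x) V is represented by a finite list of pairs [(u_i, v_i)],
   standing for \sum_i u_i (x) v_i; by the universal property a linear map
   U (x) V -> W is a curried bilinear map, and two lists denote the same tensor
   iff no bilinear map distinguishes them. *)
Definition tens_eval (k : fieldType) (U V W : lmodType k)
    (b : {linear U -> {linear V -> W}}) (s : seq (U * V)) : W :=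
  \sum_(p <- s) b p.1 p.2.

Definition tens_eq (k : fieldType) (U V : lmodType k) (s t : seq (U * V)) :=
  forall (W : lmodType k) (b : {linear U -> {linear V -> W}}),
    tens_eval b s = tens_eval b t.

(* [comul h] is a choice of Sweedler representatives h^1 (x) h^2; every axiom
   below only depends on the tensors they denote. *)
Record hopfAlgebra (k : fieldType) := HopfAlgebra {
  hopf_alg :> algType k;
  comul : hopf_alg -> seq (hopf_alg * hopf_alg);
  counit : {linear hopf_alg -> k^o};
  antipode : {linear hopf_alg -> hopf_alg};
  comul_linear : forall (W : lmodType k)
    (b : {linear hopf_alg -> {linear hopf_alg -> W}}),
    linear (fun h => tens_eval b (comul h));
  comulA : forall (W : lmodType k)
    (t : {linear hopf_alg -> {linear hopf_alg -> {linear hopf_alg -> W}}}) h,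
    \sum_(p <- comul h) \sum_(q <- comul p.1) t q.1 q.2 p.2 =
    \sum_(p <- comul h) \sum_(q <- comul p.2) t p.1 q.1 q.2;
  comul_counitl : forall h, \sum_(p <- comul h) counit p.1 *: p.2 = h;
  comul_counitr : forall h, \sum_(p <- comul h) counit p.2 *: p.1 = h;
  comul1 : tens_eq (comul 1) [:: (1, 1)];
  comulM : forall g h, tens_eq (comul (g * h))
    [seq (p.1 * q.1, p.2 * q.2) | p <- comul g, q <- comul h];
  counit1 : counit 1 = 1;
  counitM : forall g h, counit (g * h) = counit g * counit h;
  antipodel : forall h,
    \sum_(p <- comul h) antipode p.1 * p.2 = (counit h)%:A;
  antipoder : forall h,
    \sum_(p <- comul h) p.1 * antipode p.2 = (counit h)%:A }.

Section AYD.
Variables (k : fieldType) (H : hopfAlgebra k).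

Section Ops.
Variable N : lmodType k.

Definition counit_cst (n : N) (h : H) : N := counit H h *: n.

Fact counit_cst_linear n : linear (counit_cst n).
Proof. by move=> a x y; rewrite /counit_cst linearP scalerDl scalerA. Qed.
HB.instance Definition _ n :=
  GRing.isLinear.Build k H N *:%R (counit_cst n) (counit_cst_linear n).

Definition comul_pull (f : {linear H -> {linear H -> N}}) (h : H) : N :=
  tens_eval f (comul h).

HB.instance Definition _ f :=
  GRing.isLinear.Build k H N *:%R (comul_pull f) (comul_linear f).

Definition is_hmodule (act : {linear H -> {linear N -> N}}) : Prop :=
  (forall n, act 1 n = n) /\
  (forall g h n, act (g * h) n = act g (act h n)).

Definition is_contramodule (alpha : {linear {linear H -> N} -> N}) : Prop :=
  (forall f : {linear H -> {linear H -> N}},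
     alpha (alpha \o f) = alpha (comul_pull f)) /\
  (forall n, alpha (counit_cst n) = n).

Variable act : {linear H -> {linear N -> N}}.

(* x |-> h^2 f(S(h^3) x h^1), with h^1 = p.1 and h^2 (x) h^3 = q.1 (x) q.2 *)
Definition ayd_twist (h : H) (f : {linear H -> N}) (x : H) : N :=
  \sum_(p <- comul h) \sum_(q <- comul p.2)
    act q.1 (f (antipode H q.2 * x * p.1)).

Fact ayd_twist_linear h f : linear (ayd_twist h f).
Proof.
move=> a x y; rewrite /ayd_twist scaler_sumr -big_split; apply: eq_bigr => p _.
rewrite scaler_sumr -big_split; apply: eq_bigr => q _ /=.
by rewrite mulrDr mulrDl -scalerAr -scalerAl !linearP.
Qed.
HB.instance Definition _ h f :=
  GRing.isLinear.Build k H N *:%R (ayd_twist h f) (ayd_twist_linear h f).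

Definition act_at (n : N) (h : H) : N := act h n.

Fact act_at_linear n : linear (act_at n).
Proof. by move=> a x y; rewrite /act_at linearP. Qed.
HB.instance Definition _ n :=
  GRing.isLinear.Build k H N *:%R (act_at n) (act_at_linear n).

End Ops.

Record ayd_ctrmd := AYDCtrmd {
  ayd_mod :> lmodType k;
  ayd_act : {linear H -> {linear ayd_mod -> ayd_mod}};
  ayd_contra : {linear {linear H -> ayd_mod} -> ayd_mod};
  ayd_actP : is_hmodule ayd_act;
  ayd_contraP : is_contramodule ayd_contra;
  ayd_compat : forall h (f : {linear H -> ayd_mod}),
    ayd_act h (ayd_contra f) = ayd_contra (ayd_twist ayd_act h f) }.

Definition ayd_stable (N : ayd_ctrmd) : Prop :=
  forall n : N, ayd_contra N (act_at (ayd_act N) n) = n.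

Record ayd_hom (M N : ayd_ctrmd) := AYDHom {
  ayd_fun :> {linear M -> N};
  ayd_fun_act : forall h m, ayd_fun (ayd_act M h m) = ayd_act N h (ayd_fun m);
  ayd_fun_contra : forall f : {linear H -> M},
    ayd_fun (ayd_contra M f) = ayd_contra N (ayd_fun \o f) }.

Lemma ayd_hom_ext (M N : ayd_ctrmd) (f g : ayd_hom M N) : f =1 g -> f = g.
Proof.
case: f g => [f fa fc] [g ga gc] /= /linear_ext e; case: _ / e in ga gc *.
by congr AYDHom.
Qed.

Program Definition ayd_id (M : ayd_ctrmd) : ayd_hom M M :=
  @AYDHom M M idfun _ _.
Next Obligation. by congr (ayd_contra M _); apply: linear_ext. Qed.

Program Definition ayd_comp (M N P : ayd_ctrmd)
    (g : ayd_hom N P) (f : ayd_hom M N) : ayd_hom M P :=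
  @AYDHom M P (g \o f) _ _.
Next Obligation. by rewrite !ayd_fun_act. Qed.
Next Obligation.
by rewrite !ayd_fun_contra; congr (ayd_contra P _); apply: linear_ext.
Qed.

Definition aYD_ctrmd : category.
Proof.
by refine (@Category ayd_ctrmd ayd_hom ayd_id ayd_comp _ _ _) => *;
  apply: ayd_hom_ext.
Defined.

Definition saYD_ctrmd : category := full_subcat (C := aYD_ctrmd) ayd_stable.

End AYD.

Definition galg (k : fieldType) (G : groupType) : Type := {malg k[G]}.

Section GroupAlgebra.
Variables (k : fieldType) (G : groupType).
Local Notation kG := (galg k G).

HB.instance Definition _ := GRing.Lmodule.copy kG {malg k[G]}.

Definition gin (g : G) : kG := << 1 *g g >>.

Section LinearExtension.
Variables (W : lmodType k) (F : G -> W).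

Definition glin (h : kG) : W := \sum_(g <- msupp h) h@_g *: F g.

Lemma glinEw (d : {fset G}) h : (msupp h `<=` d)%fset ->
  glin h = \sum_(g <- d) h@_g *: F g.
Proof.
move=> le; rewrite [LHS](big_fset_incl _ le) => //= x xd /mcoeff_outdom ->.
by rewrite scale0r.
Qed.

Fact glin_linear : linear glin.
Proof.
move=> a x y; pose d := (msupp x `|` msupp y)%fset.
have dx : (msupp x `<=` d)%fset by exact: fsubsetUl.
have dy : (msupp y `<=` d)%fset by exact: fsubsetUr.
have dxy : (msupp (a *: x + y : {malg k[G]}) `<=` d)%fset.
  apply: fsubset_trans (msuppD_le _ _) _.
  by rewrite fsubUset dy (fsubset_trans (msuppZ_le _ _) dx).
rewrite (glinEw dx) (glinEw dy) (glinEw dxy) scaler_sumr -big_split /=.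
by apply: eq_bigr => g _; rewrite mcoeffD mcoeffZ scalerDl scalerA.
Qed.
HB.instance Definition _ := GRing.isLinear.Build k kG W *:%R glin glin_linear.

Lemma glinE g : glin (gin g) = F g.
Proof. by rewrite (glinEw msuppU_le) big_seq_fset1 mcoeffUU scale1r. Qed.

End LinearExtension.

Lemma galgE (h : kG) : h = \sum_(g <- msupp h) h@_g *: gin g.
Proof.
rewrite [LHS](monalgE (h : {malg k[G]})); apply: eq_bigr => g _.
by apply/malgP => x; rewrite mcoeffZ !mcoeffU mulrnAr mulr1.
Qed.

Lemma galg_ind (W : lmodType k) (f1 f2 : kG -> W) : linear f1 -> linear f2 ->
  (forall g, f1 (gin g) = f2 (gin g)) -> f1 =1 f2.
Proof.
move=> l1 l2 e h.
pose f1L : {linear kG -> W} := HB.pack f1 (GRing.isLinear.Build k kG W *:%R f1 l1).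
pose f2L : {linear kG -> W} := HB.pack f2 (GRing.isLinear.Build k kG W *:%R f2 l2).
rewrite -[f1]/(f1L : _ -> _) -[f2]/(f2L : _ -> _) [h]galgE !linear_sum.
by apply: eq_bigr => g _; rewrite !linearZ /= e.
Qed.

Definition gmul_lin : {linear kG -> {linear kG -> kG}} :=
  glin (fun x : G => (glin (fun y => gin (x * y)%g) : {linear kG -> kG})).

Definition gmul (a b : kG) : kG := gmul_lin a b.

Lemma gmulE x y : gmul (gin x) (gin y) = gin (x * y)%g.
Proof. by rewrite /gmul /gmul_lin /= glinE /= glinE. Qed.

Fact gmulPl b : linear (gmul^~ b).
Proof. by move=> c x y; rewrite /gmul linearP. Qed.
Fact gmulPr a : linear (gmul a).
Proof. by move=> c x y; rewrite /gmul linearP. Qed.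

Fact gmulDl : left_distributive gmul +%R.
Proof. by move=> a b c; rewrite /gmul linearD. Qed.
Fact gmulDr : right_distributive gmul +%R.
Proof. by move=> a b c; rewrite /gmul linearD. Qed.

Fact gmulA : associative gmul.
Proof.
move=> a b c.
apply: (galg_ind (f1 := fun a => gmul a (gmul b c))
                 (f2 := fun a => gmul (gmul a b) c)) => [||x] {a}.
- by move=> ? ? ? /=; rewrite !gmulPl.
- by move=> ? ? ? /=; rewrite !gmulPl.
apply: (galg_ind (f1 := fun b => gmul (gin x) (gmul b c))
                 (f2 := fun b => gmul (gmul (gin x) b) c)) => [||y] {b}.
- by move=> ? ? ? /=; rewrite gmulPl gmulPr.
- by move=> ? ? ? /=; rewrite gmulPr gmulPl.
apply: (galg_ind (f1 := fun c => gmul (gin x) (gmul (gin y) c))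
                 (f2 := fun c => gmul (gmul (gin x) (gin y)) c)) => [||z] {c}.
- by move=> ? ? ? /=; rewrite !gmulPr.
- by move=> ? ? ? /=; rewrite !gmulPr.
by rewrite !gmulE mulgA.
Qed.

Fact gmul1l : left_id (gin 1%g) gmul.
Proof.
apply: galg_ind => [c x y|c x y|g] //; first by rewrite gmulPr.
by rewrite gmulE mul1g.
Qed.
Fact gmul1r : right_id (gin 1%g) gmul.
Proof.
apply: (galg_ind (f1 := gmul^~ (gin 1%g))) => [c x y|c x y|g] //.
  by rewrite gmulPl.
by rewrite gmulE mulg1.
Qed.
Fact gin_neq0 : gin 1%g != 0.
Proof. by rewrite monalgU_eq0 oner_eq0. Qed.

HB.instance Definition _ := GRing.Zmodule_isNzRing.Build kG
  gmulA gmul1l gmul1r gmulDl gmulDr gin_neq0.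

Fact gscaleAl (c : k) (a b : kG) : c *: (a * b) = (c *: a) * b.
Proof. by rewrite -[c *: a]addr0 [RHS]gmulPl [gmul 0 b]mul0r addr0. Qed.
Fact gscaleAr (c : k) (a b : kG) : c *: (a * b) = a * (c *: b).
Proof. by rewrite -[c *: b]addr0 [RHS]gmulPr [gmul a 0]mulr0 addr0. Qed.

HB.instance Definition _ := GRing.Lmodule_isLalgebra.Build k kG gscaleAl.
HB.instance Definition _ := GRing.Lalgebra_isAlgebra.Build k kG gscaleAr.

Lemma ginM x y : gin x * gin y = gin (x * y)%g. Proof. exact: gmulE. Qed.
Lemma gin1 : gin 1%g = 1. Proof. by []. Qed.

(* Delta(h) = \sum_g h_g g (x) g *)
Definition gcomul (h : kG) : seq (kG * kG) :=
  [seq (h@_g *: gin g, gin g) | g <- msupp h].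
Definition gcounit : {linear kG -> k^o} := glin (fun _ : G => 1 : k^o).
Definition gantipode : {linear kG -> kG} := glin (fun g => gin g^-1%g).

Lemma gcounitE g : gcounit (gin g) = 1.
Proof. by rewrite /gcounit /= glinE. Qed.
Lemma gantipodeE g : gantipode (gin g) = gin g^-1%g.
Proof. by rewrite /gantipode /= glinE. Qed.

Lemma gcomulE (W : lmodType k) (F : kG -> kG -> W) :
  (forall b, scalable (F^~ b)) ->
  forall h, \sum_(p <- gcomul h) F p.1 p.2 = glin (fun g => F (gin g) (gin g)) h.
Proof.
by move=> FZ h; rewrite big_map; apply: eq_bigr => g _ /=; rewrite FZ.
Qed.

Lemma gcomul_gin (W : lmodType k) (F : kG -> kG -> W) g :
  \sum_(p <- gcomul (gin g)) F p.1 p.2 = F (gin g) (gin g).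
Proof.
rewrite /gcomul big_map /gin msuppU oner_eq0 big_seq_fset1 /= mcoeffUU.
by rewrite scale1r.
Qed.

Fact gcomul_linear (W : lmodType k) (b : {linear kG -> {linear kG -> W}}) :
  linear (fun h => tens_eval b (gcomul h)).
Proof.
move=> c x y; rewrite /tens_eval.
by rewrite !(@gcomulE W (fun u => b u)) ?linearP // => v a u; rewrite linearZ.
Qed.

Fact gcomulA (W : lmodType k)
    (t : {linear kG -> {linear kG -> {linear kG -> W}}}) h :
  \sum_(p <- gcomul h) \sum_(q <- gcomul p.1) t q.1 q.2 p.2 =
  \sum_(p <- gcomul h) \sum_(q <- gcomul p.2) t p.1 q.1 q.2.
Proof.
rewrite (@gcomulE W (fun u v => \sum_(q <- gcomul u) t q.1 q.2 v)); last first.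
  move=> v c u; rewrite !(@gcomulE W (fun a b => t a b v)) ?linearZ //.
  - by move=> ? ? ?; rewrite linearZ.
  - by move=> ? ? ?; rewrite linearZ.
rewrite (@gcomulE W (fun u v => \sum_(q <- gcomul v) t u q.1 q.2)); last first.
  by move=> v c u; rewrite scaler_sumr; apply: eq_bigr => q _; rewrite linearZ.
apply: eq_bigr => g _; congr (_ *: _).
by rewrite (gcomul_gin (fun u v => t u v _)) (gcomul_gin (fun u v => t _ u v)).
Qed.

Fact gcomul_counitl h : \sum_(p <- gcomul h) gcounit p.1 *: p.2 = h.
Proof.
rewrite (@gcomulE _ (fun u v => gcounit u *: v)); last first.
  by move=> b c a; rewrite linearZ /= -scalerA.
by rewrite [RHS]galgE; apply: eq_bigr => g _; rewrite gcounitE scale1r.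
Qed.

Fact gcomul_counitr h : \sum_(p <- gcomul h) gcounit p.2 *: p.1 = h.
Proof.
rewrite (@gcomulE _ (fun u v => gcounit v *: u)); last first.
  by move=> b c a; rewrite !scalerA mulrC.
by rewrite [RHS]galgE; apply: eq_bigr => g _; rewrite gcounitE scale1r.
Qed.

Fact gcomul1 : tens_eq (gcomul 1) [:: (1, 1)].
Proof.
by move=> W b; rewrite /tens_eval -gin1 (gcomul_gin (fun u => b u)) big_seq1.
Qed.

Fact gcomulM g h : tens_eq (gcomul (g * h))
  [seq (p.1 * q.1, p.2 * q.2) | p <- gcomul g, q <- gcomul h].
Proof.
move=> W b; rewrite {2}/tens_eval big_allpairs_dep /=.
pose Q u v h := \sum_(q <- gcomul h) b (u * q.1) (v * q.2).
rewrite -/(\sum_(p <- gcomul g) Q p.1 p.2 h).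
have QZ h' v : scalable (fun u => Q u v h').
  move=> c u; rewrite /Q scaler_sumr; apply: eq_bigr => q _.
  by rewrite -scalerAl linearZ.
have Ql u : linear (Q u u).
  move=> c x y; rewrite /Q !(@gcomulE W (fun a d => b (u * a) (u * d))) ?linearP //;
  by move=> ? ? ?; rewrite -scalerAr linearZ.
move: g; apply: galg_ind => [c x y|c x y|x].
- by rewrite mulrDl -scalerAl gcomul_linear.
- by rewrite !(@gcomulE W (fun u v => Q u v h)) ?linearP.
move: h; apply: galg_ind => [c y z|c y z|y].
- by rewrite mulrDr -scalerAr gcomul_linear.
- by rewrite !(gcomul_gin (fun u v => Q u v _)) Ql.
rewrite (gcomul_gin (fun u v => Q u v _)) /Q.
rewrite (gcomul_gin (fun u v => b (_ * u) (_ * v))).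
by rewrite ginM /tens_eval (gcomul_gin (fun u => b u)).
Qed.

Fact gcounit1 : gcounit 1 = 1. Proof. by rewrite -gin1 gcounitE. Qed.

Fact gcounitM g h : gcounit (g * h) = gcounit g * gcounit h.
Proof.
move: g; apply: galg_ind => [c x y|c x y|x].
- by rewrite mulrDl -scalerAl linearP.
- by rewrite linearP /= mulrDl -scalerAl.
move: h; apply: galg_ind => [c y z|c y z|y].
- by rewrite mulrDr -scalerAr linearP.
- by rewrite linearP /= mulrDr -scalerAr.
by rewrite ginM !gcounitE mulr1.
Qed.

Fact gantipodel h : \sum_(p <- gcomul h) gantipode p.1 * p.2 = (gcounit h)%:A.
Proof.
rewrite (@gcomulE _ (fun u v => gantipode u * v)); last first.
  by move=> v c u; rewrite linearZ /= -scalerAl.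
move: h; apply: galg_ind => [c x y|c x y|g]; first exact: linearP.
  by rewrite linearP scalerDl scalerA.
by rewrite glinE gcounitE gantipodeE ginM mulVg scale1r.
Qed.

Fact gantipoder h : \sum_(p <- gcomul h) p.1 * gantipode p.2 = (gcounit h)%:A.
Proof.
rewrite (@gcomulE _ (fun u v => u * gantipode v)); last first.
  by move=> v c u; rewrite -scalerAl.
move: h; apply: galg_ind => [c x y|c x y|g]; first exact: linearP.
  by rewrite linearP scalerDl scalerA.
by rewrite glinE gcounitE gantipodeE ginM mulgV scale1r.
Qed.

Definition group_hopf : hopfAlgebra k :=
  @HopfAlgebra k kG gcomul gcounit gantipode gcomul_linear gcomulA
    gcomul_counitl gcomul_counitr gcomul1 gcomulM gcounit1 gcounitM
    gantipodel gantipoder.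

End GroupAlgebra.

Definition gcast (k : fieldType) (G : groupType) (M : G -> lmodType k)
    (g h : G) (e : g = h) : {linear M g -> M h} :=
  match e in _ = h' return {linear M g -> M h'} with erefl => idfun end.

Section VecGG.
Variables (k : fieldType) (G : groupType).

(* The equations e between degrees below are group identities, so quantifying
   over them is not a restriction; they only serve to type the action laws. *)
Record vecGG := VecGG {
  grade :> G -> lmodType k;
  gact : forall x g, {linear grade g -> grade (x * g * x^-1)%g};
  gact1 : forall g (m : grade g) (e : (1 * g * 1^-1)%g = g),
    gcast grade e (gact 1%g g m) = m;
  gactM : forall x y g (m : grade g)
    (e : (x * (y * g * y^-1) * x^-1)%g = (x * y * g * (x * y)^-1)%g),
    gcast grade e (gact x _ (gact y g m)) = gact (x * y)%g g m }.

(* x . m = m for m in M_x, through the identification x x x^-1 = x *)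
Definition vecGG_stable (M : vecGG) : Prop :=
  forall x (m : M x) (e : (x * x * x^-1)%g = x), gcast M e (gact M x x m) = m.

Record vecGG_hom (M N : vecGG) := VecGGHom {
  gfun :> forall g, {linear M g -> N g};
  gfun_act : forall x g (m : M g), gfun _ (gact M x g m) = gact N x g (gfun g m) }.

Lemma vecGG_hom_ext (M N : vecGG) (f1 f2 : vecGG_hom M N) :
  (forall g, f1 g =1 f2 g) -> f1 = f2.
Proof.
case: f1 f2 => [f1 a1] [f2 a2] /= e.
have {}e : f1 = f2.
  by apply: functional_extensionality_dep => g; apply/linear_ext/e.
by case: _ / e in a2 *; congr VecGGHom.
Qed.

Definition vecGG_id (M : vecGG) : vecGG_hom M M :=
  @VecGGHom M M (fun g => idfun) (fun _ _ _ => erefl).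

Program Definition vecGG_comp (M N P : vecGG)
    (f2 : vecGG_hom N P) (f1 : vecGG_hom M N) : vecGG_hom M P :=
  @VecGGHom M P (fun g => f2 g \o f1 g) _.
Next Obligation. by rewrite !gfun_act. Qed.

Definition Vec_GG : category.
Proof.
by refine (@Category vecGG vecGG_hom vecGG_id vecGG_comp _ _ _) => *;
  apply: vecGG_hom_ext.
Defined.

Definition Vec'_GG : category := full_subcat (C := Vec_GG) vecGG_stable.

Definition sections (M : vecGG) : Type := forall g, M g.

Section Sections.
Variable M : vecGG.
Local Notation sM := (sections M).

HB.instance Definition _ := gen_eqMixin sM.
HB.instance Definition _ := gen_choiceMixin sM.

Lemma sect_ext (s t : sM) : (forall g, s g = t g) -> s = t.
Proof. exact: functional_extensionality_dep. Qed.

Definition sect0 : sM := fun g => 0.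
Definition sectN (s : sM) : sM := fun g => - s g.
Definition sectD (s t : sM) : sM := fun g => s g + t g.
Definition sectZ (a : k) (s : sM) : sM := fun g => a *: s g.

Fact sectDA : associative sectD.
Proof. by move=> s t u; apply: sect_ext => g; apply: addrA. Qed.
Fact sectDC : commutative sectD.
Proof. by move=> s t; apply: sect_ext => g; apply: addrC. Qed.
Fact sect0D : left_id sect0 sectD.
Proof. by move=> s; apply: sect_ext => g; apply: add0r. Qed.
Fact sectND : left_inverse sect0 sectN sectD.
Proof. by move=> s; apply: sect_ext => g; apply: addNr. Qed.
HB.instance Definition _ := GRing.isZmodule.Build sM sectDA sectDC sect0D sectND.

Fact sectZA a b s : sectZ a (sectZ b s) = sectZ (a * b) s.
Proof. by apply: sect_ext => g; apply: scalerA. Qed.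
Fact sect1Z : left_id 1 sectZ.
Proof. by move=> s; apply: sect_ext => g; apply: scale1r. Qed.
Fact sectZDr : right_distributive sectZ +%R.
Proof. by move=> a s t; apply: sect_ext => g; apply: scalerDr. Qed.
Fact sectZDl s : {morph sectZ^~ s : a b / a + b}.
Proof. by move=> a b; apply: sect_ext => g; apply: scalerDl. Qed.
HB.instance Definition _ :=
  GRing.Zmodule_isLmodule.Build k sM sectZA sect1Z sectZDr sectZDl.

Lemma sectDE (s t : sM) g : (s + t) g = s g + t g. Proof. by []. Qed.
Lemma sectZE a (s : sM) g : (a *: s) g = a *: s g. Proof. by []. Qed.

Lemma conjVK (x h : G) : (x * (x^-1 * h * x) * x^-1 = h)%g.
Proof. by rewrite -!mulgA mulgV mulg1 mulVKg. Qed.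


(* (x . m)_h = x . m_(x^-1 h x), i.e. (x . m)_(x g x^-1) = x . m_g *)
Definition sect_gact_fun (x : G) (m : sM) : sM := fun h =>
  gcast M (conjVK x h) (gact M x _ (m (x^-1 * h * x)%g)).

Fact sect_gact_linear x : linear (sect_gact_fun x).
Proof. by move=> a s t; apply: sect_ext => h; rewrite /sect_gact_fun !linearP. Qed.
HB.instance Definition _ x :=
  GRing.isLinear.Build k sM sM *:%R (sect_gact_fun x) (sect_gact_linear x).

Definition sect_gact (x : G) : {linear sM -> sM} := sect_gact_fun x.

Lemma gcast_irr (g h : G) (e1 e2 : g = h) : gcast M e1 =1 gcast M e2.
Proof. by move=> m; rewrite (Prop_irrelevance e1 e2). Qed.

Lemma gcast_id (g : G) (e : g = g) m : gcast M e m = m.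
Proof. by rewrite (gcast_irr e erefl). Qed.

Lemma gcast_comp (g h l : G) (e1 : g = h) (e2 : h = l) m :
  gcast M e2 (gcast M e1 m) = gcast M (etrans e1 e2) m.
Proof. by case: _ / e2; case: _ / e1. Qed.

Lemma gcast_sect (m : sM) (g h : G) (e : g = h) : gcast M e (m g) = m h.
Proof. by case: _ / e. Qed.

Lemma gcast_gact x (g h : G) (e : g = h) (m : M g)
    (e' : (x * g * x^-1)%g = (x * h * x^-1)%g) :
  gact M x h (gcast M e m) = gcast M e' (gact M x g m).
Proof. by case: _ / e in e' *; rewrite !gcast_id. Qed.

Lemma sect_gactE x m g : sect_gact x m (x * g * x^-1)%g = gact M x g (m g).
Proof.
have e : (x^-1 * (x * g * x^-1) * x = g)%g by rewrite -!mulgA mulVg mulg1 mulKg.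
have e' : (x * (x^-1 * (x * g * x^-1) * x) * x^-1 = x * g * x^-1)%g by rewrite e.
rewrite -[in RHS](gcast_sect m e) (gcast_gact _ _ e').
exact: gcast_irr.
Qed.

Lemma sect_extJ x (s t : sM) :
  (forall g, s (x * g * x^-1)%g = t (x * g * x^-1)%g) -> s = t.
Proof. by move=> e; apply: sect_ext => h; rewrite -(conjVK x h). Qed.

Lemma sect_gact1 m : sect_gact 1%g m = m.
Proof.
apply: (sect_extJ (x := 1%g)) => g; rewrite sect_gactE.
have e : (1 * g * 1^-1 = g)%g by rewrite mul1g invg1 mulg1.
by rewrite -[RHS](gcast_sect m (esym e)) -[in RHS](gact1 (m g) e) gcast_comp gcast_id.
Qed.

Lemma sect_gactM x y m : sect_gact (x * y)%g m = sect_gact x (sect_gact y m).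
Proof.
apply: (sect_extJ (x := (x * y)%g)) => g; rewrite sect_gactE.
have e : (x * (y * g * y^-1) * x^-1 = x * y * g * (x * y)^-1)%g.
  by rewrite invgM !mulgA.
by rewrite -(gactM (m g) e) -(gcast_sect _ e) !sect_gactE.
Qed.

Local Notation kG := (group_hopf k G).

Definition sect_act : {linear kG -> {linear sM -> sM}} := glin sect_gact.

Lemma sect_actE g : sect_act (gin k g) = sect_gact g.
Proof. exact: glinE. Qed.

Definition sect_contra_fun (f : {linear kG -> sM}) : sM := fun g => f (gin k g) g.

Fact sect_contra_linear : linear sect_contra_fun.
Proof. by move=> a f1 f2; apply: sect_ext. Qed.
HB.instance Definition _ := GRing.isLinear.Build k {linear kG -> sM} sM *:%R
  sect_contra_fun sect_contra_linear.

Definition sect_contra : {linear {linear kG -> sM} -> sM} := sect_contra_fun.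

Lemma sect_actP : is_hmodule sect_act.
Proof.
split=> [m|a b m]; first by rewrite -[1 : kG]/(gin k 1%g) sect_actE sect_gact1.
move: a; apply: (galg_ind (f1 := fun a => sect_act (a * b) m)
                          (f2 := fun a => sect_act a (sect_act b m)))
  => [c x y|c x y|x].
- by rewrite mulrDl -scalerAl linearP.
- by rewrite linearP.
move: b; apply: (galg_ind (f1 := fun b => sect_act (gin k x * b) m)
                          (f2 := fun b => sect_act (gin k x) (sect_act b m)))
  => [c y z|c y z|y].
- by rewrite mulrDr -scalerAr linearP.
- by rewrite !linearP.
by rewrite ginM !sect_actE sect_gactM.
Qed.

Lemma sect_contraP : is_contramodule sect_contra.
Proof.
split=> [f|m]; apply: sect_ext => g.
  by rewrite /= /sect_contra_fun /= /comul_pull /tens_eval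
    (gcomul_gin (fun u => f u)).
by rewrite /= /sect_contra_fun /= /counit_cst gcounitE scale1r.
Qed.

Lemma sect_compat h (f : {linear kG -> sM}) :
  sect_act h (sect_contra f) = sect_contra (ayd_twist sect_act h f).
Proof.
apply: sect_ext => g.
pose F u v := (\sum_(q <- comul v)
  sect_act q.1 (f (antipode kG q.2 * gin k g * u)) : sM).
rewrite -[RHS]/((\sum_(p <- gcomul h) F p.1 p.2) g).
have FZ v : scalable (F^~ v).
  move=> c u; rewrite /F scaler_sumr; apply: eq_bigr => q _.
  by rewrite -scalerAr !linearZ.
rewrite (gcomulE FZ).
move: h; apply: (galg_ind (f1 := fun h => sect_act h (sect_contra f) g)
  (f2 := fun h => glin (fun x => F (gin k x) (gin k x)) h g)) => [c y z|c y z|x].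
- by rewrite linearP.
- by rewrite linearP.
rewrite glinE sect_actE /F.
rewrite (gcomul_gin (fun u v => sect_act u (f (antipode kG v * _ * _)))).
rewrite sect_actE [antipode kG _]gantipodeE !ginM.
by rewrite /= /sect_gact_fun.
Qed.

Definition gamma_obj : ayd_ctrmd kG :=
  @AYDCtrmd k kG sM sect_act sect_contra sect_actP sect_contraP sect_compat.

Lemma gamma_stable : vecGG_stable M -> ayd_stable gamma_obj.
Proof.
move=> st m; apply: sect_ext => g.
have e : (g * g * g^-1 = g)%g by rewrite mulgK.
rewrite -[LHS]/(sect_act (gin k g) m g) sect_actE.
by rewrite -(gcast_sect _ e) sect_gactE st.
Qed.

End Sections.

Section GammaHom.
Variables (M N : vecGG) (phi : vecGG_hom M N).

Definition gamma_fun (m : sections M) : sections N := fun g => phi g (m g).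

Fact gamma_fun_linear : linear gamma_fun.
Proof. by move=> a s t; apply: sect_ext => g; rewrite /gamma_fun linearP. Qed.
HB.instance Definition _ := GRing.isLinear.Build k (sections M) (sections N)
  *:%R gamma_fun gamma_fun_linear.

Lemma gamma_fun_act (h : group_hopf k G) (m : gamma_obj M) :
  gamma_fun (ayd_act (gamma_obj M) h m) =
  ayd_act (gamma_obj N) h (gamma_fun m).
Proof.
move: h; apply: galg_ind => [c x y|c x y|x].
- by rewrite !linearP.
- by rewrite !linearP.
rewrite /= !sect_actE; apply: (sect_extJ (x := x)) => g.
by rewrite /gamma_fun !sect_gactE gfun_act.
Qed.

Definition gamma_hom : ayd_hom (gamma_obj M) (gamma_obj N) :=
  @AYDHom k (group_hopf k G) (gamma_obj M) (gamma_obj N) gamma_fun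
    gamma_fun_act (fun _ => erefl).

End GammaHom.

Program Definition Gamma_GG : functor Vec_GG (aYD_ctrmd (group_hopf k G)) :=
  @Functor Vec_GG (aYD_ctrmd (group_hopf k G)) gamma_obj gamma_hom _ _.
Next Obligation. exact: ayd_hom_ext. Qed.
Next Obligation. exact: ayd_hom_ext. Qed.

Definition Gamma : functor Vec'_GG (saYD_ctrmd (group_hopf k G)) :=
  full_restr (F := Gamma_GG) gamma_stable.

End VecGG.

(* Main.v *)
Require Import Defs.
From HB Require Import structures.
From mathcomp Require Import all_boot all_order all_algebra.
From mathcomp Require Import classical_sets cardinality.

(** A contraaction of [kG] on [N] is a linear map [alpha : N^G -> N] with
    [alpha (x |-> alpha (F x)) = alpha (x |-> F x x)] and [alpha (cst n) = n].
    The maps [p_g n = alpha (delta_g n)] are idempotents with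
    [p_g (alpha F) = p_g (F g)], and they are jointly injective, so that
    [N] is the product of the images [N_g] of the [p_g], a family
    [(n_g)_g] corresponding to [alpha (g |-> n_g)]. The anti-Yetter-Drinfeld
    condition at a group element [x] gives [x p_g = p_(x g x^-1) x], so [G]
    permutes the [N_g] as required, and stability gives [p_g (g n) = p_g n],
    i.e. [g] acts trivially on [N_g]. The functor [N |-> (N_g)_g] is the inverse
    of [Gamma]. *)

Set Implicit Arguments.
Unset Strict Implicit.
Unset Printing Implicit Defensive.

Import GRing.Theory.
Local Open Scope ring_scope.

(** * Subspaces of fixed vectors of a linear endomorphism *)

Section FixedSubspace.
Variables (k : fieldType) (V : lmodType k) (p : {linear V -> V}).

Definition fixed_pred : pred V := [pred v | p v == v].

Fact fixed_submod_closed : submod_closed fixed_pred.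
Proof.
split=> [|a u v /eqP pu /eqP pv]; first by rewrite inE linear0.
by rewrite inE linearP pu pv.
Qed.
HB.instance Definition _ :=
  GRing.isSubmodClosed.Build k V fixed_pred fixed_submod_closed.

(** For an idempotent [p] this is the image of [p]. Describing it by the equation [p v = v] makes it
    a subtype that inherits its module structure from [V]. *)
Record fixed_sub := FixedSub { fixed_val : V; _ : fixed_val \in fixed_pred }.
HB.instance Definition _ := [isSub for fixed_val].
HB.instance Definition _ := [Choice of fixed_sub by <:].
HB.instance Definition _ := [SubChoice_isSubLmodule of fixed_sub by <:].

Definition fixed_incl : {linear fixed_sub -> V} := val.

Lemma fixed_inclK (v : fixed_sub) : p (fixed_incl v) = fixed_incl v.
Proof. exact/eqP/(valP v). Qed.

Lemma fixed_incl_inj : injective fixed_incl.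
Proof. exact: val_inj. Qed.

Section Corestriction.
Variables (U : lmodType k) (f : {linear U -> V}).
Hypothesis pf : forall u, p (f u) = f u.

Definition fixed_corestr_fun (u : U) : fixed_sub := FixedSub (introT eqP (pf u)).

Fact fixed_corestr_linear : linear fixed_corestr_fun.
Proof. by move=> a u v; apply: fixed_incl_inj; rewrite linearP /= linearP. Qed.
HB.instance Definition _ := GRing.isLinear.Build k U fixed_sub *:%R
  fixed_corestr_fun fixed_corestr_linear.

Definition fixed_corestr : {linear U -> fixed_sub} := fixed_corestr_fun.

Lemma fixed_corestrE u : fixed_incl (fixed_corestr u) = f u.
Proof. by []. Qed.

End Corestriction.

End FixedSubspace.

Arguments fixed_incl {k V p}.

(** * Linear maps out of $kG$ as functions on $G$ *)

Section GroupAlgebraMaps.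
Variables (k : fieldType) (G : groupType).
Local Notation kG := (group_hopf k G).

Lemma glin_ext (W : lmodType k) (f1 f2 : {linear kG -> W}) :
  (forall g, f1 (gin k g) = f2 (gin k g)) -> f1 = f2.
Proof.
by move=> e; apply: linear_ext; apply: galg_ind => // a x y; rewrite linearP.
Qed.

Definition glinL (W : lmodType k) (F : G -> W) : {linear kG -> W} := glin F.

Lemma glinLE (W : lmodType k) (F : G -> W) g : glinL F (gin k g) = F g.
Proof. exact: glinE. Qed.

Lemma eq_glinL (W : lmodType k) (F1 F2 : G -> W) :
  F1 =1 F2 -> glinL F1 = glinL F2.
Proof. by move=> e; apply: glin_ext => g; rewrite !glinLE. Qed.

Lemma glinL_eta (W : lmodType k) (f : {linear kG -> W}) :
  f = glinL (fun g => f (gin k g)).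
Proof. by apply: glin_ext => g; rewrite glinLE. Qed.

End GroupAlgebraMaps.

Section Components.
Variables (k : fieldType) (G : groupType).
Local Notation kG := (group_hopf k G).

(** * The idempotents and graded components of a contramodule *)

Section OneContramodule.
Variable N : ayd_ctrmd kG.

Definition galpha (F : G -> N) : N := ayd_contra N (glinL F).
Definition gdo (x : G) : {linear N -> N} := ayd_act N (gin k x).

Lemma eq_galpha (F1 F2 : G -> N) : F1 =1 F2 -> galpha F1 = galpha F2.
Proof. by move=> e; rewrite /galpha (eq_glinL e). Qed.

Lemma galphaP a (F1 F2 : G -> N) :
  galpha (fun g => a *: F1 g + F2 g) = a *: galpha F1 + galpha F2.
Proof.
rewrite -linearP; congr (ayd_contra N _).
by apply: glin_ext => g; rewrite lhomDE lhomZE !glinLE.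
Qed.

Lemma galpha_cst n : galpha (fun=> n) = n.
Proof.
have [_ e] := ayd_contraP N; rewrite -[RHS]e; congr (ayd_contra N _).
by apply: glin_ext => g; rewrite glinLE /= /counit_cst gcounitE scale1r.
Qed.

(** Since $\Delta(g) = g \otimes g$, pulling back along the comultiplication restricts a function on
    $G \times G$ to the diagonal. *)
Lemma galpha_diag (F : G -> G -> N) :
  galpha (fun x => galpha (F x)) = galpha (fun x => F x x).
Proof.
have [e _] := ayd_contraP N.
have := e (glinL (fun x => glinL (F x))).
have -> : (ayd_contra N \o glinL (fun x => glinL (F x)) : {linear kG -> N}) =
          glinL (fun x => galpha (F x)).
  by apply: glin_ext => g; rewrite /= !glinLE.
move=> eF; apply: (etrans eF); congr (ayd_contra N _); apply: glin_ext => g.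
rewrite glinLE /= /comul_pull /tens_eval.
by rewrite (gcomul_gin (fun u => glinL (fun x => glinL (F x)) u)) !glinLE.
Qed.

Lemma gdo1 n : gdo 1%g n = n.
Proof. by have [e _] := ayd_actP N; apply: e. Qed.

Lemma gdoM x y n : gdo (x * y)%g n = gdo x (gdo y n).
Proof. by have [_ e] := ayd_actP N; rewrite /gdo -e -ginM. Qed.

(** For $h = x$ in $G$ all three Sweedler factors are $x$, so the twisted map is $y \mapsto x
    f(x^{-1} y x)$. *)
Lemma gdo_galpha x (F : G -> N) :
  gdo x (galpha F) = galpha (fun y => gdo x (F (x^-1 * y * x)%g)).
Proof.
rewrite /gdo /galpha ayd_compat; congr (ayd_contra N _).
apply: glin_ext => y; rewrite glinLE /= /ayd_twist.
rewrite (gcomul_gin (fun u v => \sum_(q <- gcomul v)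
  ayd_act N q.1 (glinL F (gantipode k G q.2 * gin k y * u)))).
rewrite (gcomul_gin (fun u v =>
  ayd_act N u (glinL F (gantipode k G v * gin k y * gin k x)))).
by rewrite gantipodeE !ginM glinLE.
Qed.

Definition gproj_fun (g : G) (n : N) : N :=
  galpha (fun h => if h == g then n else 0).

Fact gproj_linear g : linear (gproj_fun g).
Proof.
move=> a m n; rewrite -galphaP; apply: eq_galpha => h.
by case: ifP; rewrite // scaler0 addr0.
Qed.
HB.instance Definition _ g :=
  GRing.isLinear.Build k N N *:%R (gproj_fun g) (gproj_linear g).

Definition gproj (g : G) : {linear N -> N} := gproj_fun g.

Lemma gproj_galpha g (F : G -> N) : gproj g (galpha F) = gproj g (F g).
Proof.
(* Each entry of the delta family is itself a contraaction: of [F] at [x = g], of the constant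
   family 0 elsewhere. On the diagonal only [F g] survives. *)
transitivity (galpha (fun x => galpha (fun y => if x == g then F y else 0))).
  by apply: eq_galpha => x; case: ifP => // _; rewrite galpha_cst.
by rewrite galpha_diag; apply: eq_galpha => x; case: eqP => // ->.
Qed.

Lemma gproj_idem g n : gproj g (gproj g n) = gproj g n.
Proof. by rewrite [in LHS]/gproj /= gproj_galpha eqxx. Qed.

(* With [F x y = [y != x] n], vanishing of all [gproj x n] says that
   [galpha (F x) = n] for every [x], while the diagonal of [F] is [0]. *)
Lemma gproj_eq0 n : (forall g, gproj g n = 0) -> n = 0.
Proof.
move=> n0; pose F (x y : G) : N := if y == x then 0 else n.
have Fn x : galpha (F x) = n.
  rewrite -[LHS]add0r -(n0 x) -[gproj x n]scale1r -galphaP -[RHS]galpha_cst.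
  by apply: eq_galpha => y; rewrite /F scale1r; case: ifP; rewrite ?addr0 ?add0r.
rewrite -[LHS]galpha_cst -(eq_galpha Fn) galpha_diag -[RHS]galpha_cst.
by apply: eq_galpha => x; rewrite /F eqxx.
Qed.

Lemma gproj_inj m n : (forall g, gproj g m = gproj g n) -> m = n.
Proof.
by move=> e; apply/subr0_eq/gproj_eq0 => g; rewrite linearB e subrr.
Qed.

(** Conjugation by [x] moves the support of the delta family from $g$ to $x g x^{-1}$. *)
Lemma gdo_gproj x g n :
  gdo x (gproj g n) = gproj (x * g * x^-1)%g (gdo x n).
Proof.
rewrite gdo_galpha; apply: eq_galpha => y.
have -> : (x^-1 * y * x == g)%g = (y == x * g * x^-1)%g.
  by apply/eqP/eqP => [<-|->]; rewrite -!mulgA ?mulgV ?mulVg ?mulg1 ?mulVKg ?mulKg.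
by case: ifP => // _; rewrite linear0.
Qed.

(** Stability presents [n] as the contraaction of $x \mapsto x n$, whose entry at $g$ is $g n$. *)
Lemma gproj_stable g n : ayd_stable N -> gproj g (gdo g n) = gproj g n.
Proof.
move=> st; rewrite -[in RHS](st n) -(gproj_galpha g (fun x => gdo x n)).
by congr (gproj g (ayd_contra N _)); apply: glin_ext => x; rewrite glinLE.
Qed.

Definition comp_grade (g : G) : lmodType k := fixed_sub (gproj g).

Fact comp_gact_fixed x g (m : comp_grade g) :
  gproj (x * g * x^-1)%g (gdo x (fixed_incl m)) = gdo x (fixed_incl m).
Proof. by rewrite -gdo_gproj fixed_inclK. Qed.

Definition comp_gact x g : {linear comp_grade g -> comp_grade (x * g * x^-1)%g} :=
  fixed_corestr (f := gdo x \o @fixed_incl _ _ (gproj g)) (@comp_gact_fixed x g).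

(** All components lie in the same space [N], so transports between equal degrees disappear there
    and the action laws can be checked in [N]. *)
Lemma fixed_incl_cast g h (e : g = h) (m : comp_grade g) :
  fixed_incl (gcast comp_grade e m) = fixed_incl m.
Proof. by case: _ / e. Qed.

Fact comp_gact1 g (m : comp_grade g) (e : (1 * g * 1^-1)%g = g) :
  gcast comp_grade e (comp_gact 1%g g m) = m.
Proof. by apply: fixed_incl_inj; rewrite fixed_incl_cast fixed_corestrE /= gdo1. Qed.

Fact comp_gactM x y g (m : comp_grade g)
    (e : (x * (y * g * y^-1) * x^-1)%g = (x * y * g * (x * y)^-1)%g) :
  gcast comp_grade e (comp_gact x _ (comp_gact y g m)) = comp_gact (x * y)%g g m.
Proof.
by apply: fixed_incl_inj; rewrite fixed_incl_cast !fixed_corestrE /= gdoM.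
Qed.

Definition comp_obj : vecGG k G := VecGG comp_gact1 comp_gactM.

Lemma comp_stable : ayd_stable N -> vecGG_stable comp_obj.
Proof.
move=> st x m e; apply: fixed_incl_inj; rewrite fixed_incl_cast fixed_corestrE.
(* Writing $m = p_x m$ gives $x m = p_{x x x^{-1}}(x m) = p_x(x m) = p_x m = m$. *)
rewrite -[LHS]/(gdo x (fixed_incl m)) -[in LHS]fixed_inclK.
by rewrite gdo_gproj e gproj_stable // fixed_inclK.
Qed.

End OneContramodule.

(** * Functoriality of the components *)

Section CompHom.
Variables (M N : ayd_ctrmd kG) (phi : ayd_hom M N).

Lemma ayd_hom_gdo x m : phi (gdo M x m) = gdo N x (phi m).
Proof. exact: ayd_fun_act. Qed.

Lemma ayd_hom_galpha (F : G -> M) : phi (galpha F) = galpha (phi \o F).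
Proof.
rewrite /galpha ayd_fun_contra; congr (ayd_contra N _).
by apply: glin_ext => g; rewrite /= !glinLE.
Qed.

Lemma ayd_hom_gproj g m : phi (gproj M g m) = gproj N g (phi m).
Proof.
rewrite ayd_hom_galpha; apply: eq_galpha => h /=.
by case: ifP => // _; rewrite linear0.
Qed.

Fact comp_fun_fixed g (m : comp_obj M g) :
  gproj N g (phi (fixed_incl m)) = phi (fixed_incl m).
Proof. by rewrite -ayd_hom_gproj fixed_inclK. Qed.

Definition comp_fun g : {linear comp_obj M g -> comp_obj N g} :=
  fixed_corestr (f := phi \o @fixed_incl _ _ (gproj M g)) (@comp_fun_fixed g).

Fact comp_fun_act x g (m : comp_obj M g) :
  comp_fun _ (gact (comp_obj M) x g m) = gact (comp_obj N) x g (comp_fun g m).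
Proof. by apply: fixed_incl_inj; rewrite /= ayd_hom_gdo. Qed.

Definition comp_hom : vecGG_hom (comp_obj M) (comp_obj N) := VecGGHom comp_fun_act.

End CompHom.

Definition Comp : functor (aYD_ctrmd kG) (Vec_GG k G).
Proof.
by refine (@Functor (aYD_ctrmd kG) (Vec_GG k G) comp_obj comp_hom _ _) => *;
  apply: vecGG_hom_ext => g m; apply: fixed_incl_inj.
Defined.

(** * A contramodule is the product of its components *)

Section GammaComp.
Variable N : ayd_ctrmd kG.

Definition gather_fun (s : sections (comp_obj N)) : N :=
  galpha (fun g => fixed_incl (s g)).

Fact gather_linear : linear gather_fun.
Proof.
by move=> a s t; rewrite -galphaP; apply: eq_galpha => g; rewrite -linearP.
Qed.
HB.instance Definition _ := GRing.isLinear.Build k (sections (comp_obj N)) N *:%R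
  gather_fun gather_linear.

Definition gather : {linear sections (comp_obj N) -> N} := gather_fun.

Definition scatter_fun (n : N) : sections (comp_obj N) :=
  fun g => fixed_corestr (gproj_idem (N := N) g) n.

Fact scatter_linear : linear scatter_fun.
Proof. by move=> a m n; apply: sect_ext => g; rewrite /scatter_fun linearP. Qed.
HB.instance Definition _ := GRing.isLinear.Build k N (sections (comp_obj N)) *:%R
  scatter_fun scatter_linear.

Definition scatter : {linear N -> sections (comp_obj N)} := scatter_fun.

Lemma fixed_incl_scatter n g : fixed_incl (scatter n g) = gproj N g n.
Proof. by []. Qed.

Lemma gproj_gather g s : gproj N g (gather s) = fixed_incl (s g).
Proof. by rewrite gproj_galpha fixed_inclK. Qed.

Lemma gatherK : cancel gather scatter.
Proof.
move=> s; apply: sect_ext => g; apply: fixed_incl_inj.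
by rewrite fixed_incl_scatter gproj_gather.
Qed.

(** Both sides have the same image under every [gproj g], and these maps are jointly injective. *)
Lemma scatterK : cancel scatter gather.
Proof. by move=> n; apply: gproj_inj => g; rewrite gproj_gather. Qed.

Lemma scatter_act h n :
  scatter (ayd_act N h n) = ayd_act (gamma_obj (comp_obj N)) h (scatter n).
Proof.
move: h; apply: galg_ind => [c x y|c x y|x].
- by rewrite !linearP.
- by rewrite !linearP.
(* Comparing in degrees $x g x^{-1}$ lets [sect_gactE] compute the action without a transport. *)
rewrite /= sect_actE; apply: (sect_extJ (x := x)) => g.
by rewrite sect_gactE; apply: fixed_incl_inj; rewrite /= -gdo_gproj.
Qed.

Lemma scatter_contra (f : {linear kG -> N}) :
  scatter (ayd_contra N f) = ayd_contra (gamma_obj (comp_obj N)) (scatter \o f).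
Proof.
apply: sect_ext => g; apply: fixed_incl_inj.
rewrite [in LHS](glinL_eta f) fixed_incl_scatter.
exact: (gproj_galpha g (fun x => f (gin k x))).
Qed.

Definition scatter_hom : ayd_hom N (gamma_obj (comp_obj N)) :=
  @AYDHom k kG N (gamma_obj (comp_obj N)) scatter scatter_act scatter_contra.

Lemma gather_act h s :
  gather (ayd_act (gamma_obj (comp_obj N)) h s) = ayd_act N h (gather s).
Proof. by rewrite -{1}(gatherK s) -scatter_act scatterK. Qed.

Lemma gather_contra (f : {linear kG -> gamma_obj (comp_obj N)}) :
  gather (ayd_contra (gamma_obj (comp_obj N)) f) = ayd_contra N (gather \o f).
Proof.
rewrite -[RHS]scatterK scatter_contra; congr (gather (ayd_contra (gamma_obj (comp_obj N)) _)).
by apply: linear_ext => h; rewrite /= gatherK.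
Qed.

Definition gather_hom : ayd_hom (gamma_obj (comp_obj N)) N :=
  @AYDHom k kG (gamma_obj (comp_obj N)) N gather gather_act gather_contra.

End GammaComp.

(** * Recovering a graded space from its global sections *)

Section CompGamma.
Variable M : vecGG k G.

(** On global sections [gproj g] is truncation to degree [g], so its fixed vectors are the sections
    supported at [g]. *)
Lemma gproj_sections g (s : gamma_obj M) h :
  (gproj (gamma_obj M) g s : sections M) h = if h == g then s h else 0.
Proof.
rewrite -[LHS]/(glinL (fun x => if x == g then s else 0) (gin k h) h) glinLE.
by case: ifP.
Qed.

Definition germ_fun g (s : comp_obj (gamma_obj M) g) : M g :=
  (fixed_incl s : sections M) g.

Fact germ_linear g : linear (@germ_fun g).
Proof. by move=> a s t; rewrite /germ_fun linearP. Qed.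
HB.instance Definition _ g := GRing.isLinear.Build k
  (comp_obj (gamma_obj M) g) (M g) *:%R (@germ_fun g) (@germ_linear g).

Definition germ g : {linear comp_obj (gamma_obj M) g -> M g} := @germ_fun g.

Lemma germ_act x g (s : comp_obj (gamma_obj M) g) :
  germ _ (gact (comp_obj (gamma_obj M)) x g s) = gact M x g (germ g s).
Proof. by rewrite -sect_gactE -sect_actE. Qed.

Definition germ_hom : vecGG_hom (comp_obj (gamma_obj M)) M := VecGGHom germ_act.

(** Matching on the reflection proof, not on the boolean [g == h], provides the equation along which
    [m] is transported. *)
Definition skyscraper_fun g (m : M g) : sections M := fun h =>
  if @eqP _ g h is ReflectT e then gcast M e m else 0.

Lemma skyscraper_at g m : @skyscraper_fun g m g = m.
Proof. by rewrite /skyscraper_fun; case: eqP => // e; rewrite gcast_id. Qed.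

Lemma skyscraper_off g m h : h != g -> @skyscraper_fun g m h = 0.
Proof. by move=> /eqP ne; rewrite /skyscraper_fun; case: eqP => // e; case: ne. Qed.

Fact skyscraper_linear g : linear (@skyscraper_fun g).
Proof.
move=> a m n; apply: sect_ext => h; rewrite sectDE sectZE /skyscraper_fun.
by case: eqP => [e|_]; rewrite ?linearP // scaler0 addr0.
Qed.
HB.instance Definition _ g := GRing.isLinear.Build k
  (M g) (sections M) *:%R (@skyscraper_fun g) (@skyscraper_linear g).

Fact skyscraper_fixed g (m : M g) :
  gproj (gamma_obj M) g (skyscraper_fun m) = skyscraper_fun m.
Proof.
apply: sect_ext => h; rewrite gproj_sections.
by case: (boolP (h == g)) => // ne; rewrite skyscraper_off.
Qed.

Definition skyscraper g : {linear M g -> comp_obj (gamma_obj M) g} :=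
  fixed_corestr (f := @skyscraper_fun g) (@skyscraper_fixed g).

Lemma germK g : cancel (germ g) (skyscraper g).
Proof.
(* Replacing [s] by its truncation makes it visibly 0 off degree [g]. *)
move=> s; apply: fixed_incl_inj; rewrite -[RHS]fixed_inclK.
apply: sect_ext => h; rewrite gproj_sections fixed_corestrE /=.
case: (eqVneq h g) => [->|ne]; first by rewrite skyscraper_at.
by rewrite skyscraper_off.
Qed.

Lemma skyscraperK g : cancel (skyscraper g) (germ g).
Proof. by move=> m; apply: skyscraper_at. Qed.

Lemma skyscraper_act x g (m : M g) :
  skyscraper _ (gact M x g m) = gact (comp_obj (gamma_obj M)) x g (skyscraper g m).
Proof. by apply: (can_inj (@germK _)); rewrite skyscraperK germ_act skyscraperK. Qed.

Definition skyscraper_hom : vecGG_hom M (comp_obj (gamma_obj M)) :=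
  VecGGHom skyscraper_act.

End CompGamma.

(** * Natural isomorphisms and their restriction to stable objects *)

Definition germ_iso : nat_iso (functor_comp Comp (Gamma_GG k G)) (functor_id _).
Proof.
refine (@NatIso _ _ (functor_comp Comp (Gamma_GG k G)) (functor_id _)
  germ_hom skyscraper_hom _ _ _) => *; apply: vecGG_hom_ext => g m //=.
- exact: germK.
- exact: skyscraperK.
Defined.

Definition gather_iso : nat_iso (functor_comp (Gamma_GG k G) Comp) (functor_id _).
Proof.
refine (@NatIso _ _ (functor_comp (Gamma_GG k G) Comp) (functor_id _)
  gather_hom scatter_hom _ _ _) => [M N f|N|N]; apply: ayd_hom_ext => s /=.
(* Naturality of [gather] is the compatibility of [f] with the contraactions. *)
- by rewrite [RHS](ayd_hom_galpha f).
- exact: gatherK.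
- exact: scatterK.
Defined.

End Components.

(** Full subcategories keep all morphisms and their composition, so the ambient isomorphism and its
    laws restrict as they stand. *)
Definition full_restr_comp_iso (C D : category) (F : functor C D) (K : functor D C)
    (P : C -> Prop) (Q : D -> Prop) (PQ : forall x, P x -> Q (F x))
    (QP : forall y, Q y -> P (K y)) :
  nat_iso (functor_comp K F) (functor_id C) ->
  nat_iso (functor_comp (full_restr QP) (full_restr PQ)) (functor_id _).
Proof.
move=> a.
exact: (@NatIso _ _ (functor_comp (full_restr QP) (full_restr PQ)) (functor_id _)
  (fun x => iso_fwd a (sval x)) (fun x => iso_bwd a (sval x))
  (fun x y f => @iso_natural _ _ _ _ a (sval x) (sval y) f)
  (fun x => iso_fwdK a (sval x)) (fun x => iso_bwdK a (sval x))).
Defined.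

Theorem corollary4p10 (k : fieldType) (k_char0 : [pchar k]%R =i pred0)
  (G : groupType) (G_infinite : infinite_set [set: G]%classic) :
  is_equivalence (Gamma k G).
Proof.
exists (full_restr (F := Comp k G) (@comp_stable k G)); split; constructor.
- exact: full_restr_comp_iso (germ_iso k G).
- exact: full_restr_comp_iso (gather_iso k G).
Qed.
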